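(* Let $A,B$ be complex $3\times 3$ matrices. The following are equivalent: (1) $A$ and $B$ have identical pseudospectra, i.e. $\|(zI-A)^{-1}\|=\|(zI-B)^{-1}\|$ for all $z\in\mathbb{C}$; (2) $A$ and $B$ are polynomially isometric, i.e. $\|p(A)\|=\|p(B)\|$ for every complex polynomial $p$. Moreover, if $A$ and $B$ also have the same minimal polynomial and it has degree $2$, then (1) and (2) are equivalent to (3) $\|A-\gamma_AI\|_F=\|B-\gamma_BI\|_F$, where $\gamma_A$ and $\gamma_B$ are the eigenvalues of $A$ and of $B$, respectively, of largest multiplicity.
   Context: $\|\cdot\|$ is the spectral norm and $\|T\|_F=\sqrt{\operatorname{tr}T^*T}$ the Frobenius norm. By convention $\|(zI-T)^{-1}\|=\infty$ for $z$ an eigenvalue of $T$. *)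

(* Defs.v *)
From mathcomp Require Import all_boot all_order all_algebra.
From mathcomp Require Export complex.
From mathcomp Require Import classical_sets reals constructive_ereal.
Set Implicit Arguments. Unset Strict Implicit. Unset Printing Implicit Defensive.
Import Order.TTheory GRing.Theory Num.Theory.
Local Open Scope ring_scope.
Local Open Scope classical_set_scope.

Section Norms.
Variable R : realType.
Local Notation C := R[i].

Definition vnorm n (x : 'cV[C]_n) : R :=
  Num.sqrt (\sum_(k < n) Normc.normc (x k 0) ^+ 2).

Definition specnorm m n (T : 'M[C]_(m, n)) : R :=
  sup [set vnorm (T *m x) | x in [set x : 'cV[C]_n | vnorm x = 1]].

Definition frobnorm m n (T : 'M[C]_(m, n)) : R :=
  Num.sqrt (\sum_(i < m) \sum_(j < n) Normc.normc (T i j) ^+ 2).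

Definition resolvent_norm n (T : 'M[C]_n) (z : C) : \bar R :=
  if (z%:M - T) \in unitmx then ((specnorm (invmx (z%:M - T)))%:E)%E
  else (+oo)%E.

Definition same_pseudospectra n (A B : 'M[C]_n) : Prop :=
  forall z : C, resolvent_norm A z = resolvent_norm B z.

Definition poly_isometric n (A B : 'M[C]_n.+1) : Prop :=
  forall p : {poly C}, specnorm (horner_mx A p) = specnorm (horner_mx B p).

Definition largest_mult_eigenvalue n (T : 'M[C]_n) (g : C) : Prop :=
  root (char_poly T) g /\
  forall mu : C, (mup mu (char_poly T) <= mup g (char_poly T))%N.

End Norms.

(* Main.v *)
(*
  [specnorm T ^+ 2] is the largest eigenvalue of [T^t* *m T], hence the largest
  root of [t^3 - |T|_F^2 t^2 + |adj T|_F^2 t - |det T|^2].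

  The resolvent of [A] at [z] is [m(z)^-1] times a polynomial in [A] which only
  depends on [z] and on the minimal polynomial [m]. So isometric matrices have
  equal pseudospectra; conversely, comparing the poles of the two resolvents
  shows that equal pseudospectra force equal minimal polynomials.

  If [m] has degree 3, subtracting the cubics of [z - A] and [z - B] yields
  [f z * s = |m(z)|^2 * k], where [s] is the common squared norm of the
  adjugates, [k = |A|_F^2 - |B|_F^2] and [f z] is the difference of the squared
  Frobenius norms of the adjugates. When [k = 0] all forms [tr (p(A)^* q(A))]
  agree with those of [B], and so do the cubics of [p(A)] and [p(B)]. When
  [k <> 0], the bound of [|(z - A) v|] from below at large [z] makes [A] scalar.

  If [m = (X - g) (X - h)] with [g] the double eigenvalue, [A - g] has rank one
  and the cubic of [p(A)] splits off the factor [t - |p(g)|^2]; the remaining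
  quadratic is symmetric in [g] and [h], always carries the largest root, and
  depends on [A] only through [|A - g|_F^2 - |h - g|^2].
*)
Require Import Defs.
From mathcomp Require Import all_boot all_order all_algebra.
From mathcomp Require Import complex classical_sets reals constructive_ereal.
From mathcomp Require Import ring.
Import Order.TTheory GRing.Theory Num.Theory.
Local Open Scope ring_scope.
Set Implicit Arguments.
Unset Strict Implicit.
Unset Printing Implicit Defensive.
Local Open Scope sesquilinear_scope.

(** * Hilbert-Schmidt forms and spectral norms *)

Section HilbertSchmidt.
Variable C : numClosedFieldType.

Definition mxdot m n (S T : 'M[C]_(m, n)) : C := \tr (S^t* *m T).
Definition fro m n (T : 'M[C]_(m, n)) : C := mxdot T T.

Lemma mxdotE m n (S T : 'M[C]_(m, n)) :
  mxdot S T = \sum_i \sum_j (S i j)^* * T i j.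
Proof.
rewrite /mxdot /mxtrace exchange_big /=; apply: eq_bigr => j _.
by rewrite mxE; apply: eq_bigr => i _; rewrite !mxE.
Qed.

Lemma froE m n (T : 'M[C]_(m, n)) : fro T = \sum_i \sum_j `|T i j| ^+ 2.
Proof.
rewrite /fro mxdotE; apply: eq_bigr => i _; apply: eq_bigr => j _.
by rewrite normCK mulrC.
Qed.

Lemma mxdotC m n (S T : 'M[C]_(m, n)) : (mxdot S T)^* = mxdot T S.
Proof.
rewrite !mxdotE rmorph_sum; apply: eq_bigr => i _.
by rewrite rmorph_sum; apply: eq_bigr => j _; rewrite rmorphM /= conjCK mulrC.
Qed.

Lemma mxdotDr m n (S T U : 'M[C]_(m, n)) :
  mxdot S (T + U) = mxdot S T + mxdot S U.
Proof. by rewrite /mxdot mulmxDr mxtraceD. Qed.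

Lemma mxdotZr m n (S T : 'M[C]_(m, n)) a : mxdot S (a *: T) = a * mxdot S T.
Proof. by rewrite /mxdot -scalemxAr mxtraceZ. Qed.

Lemma mxdotDl m n (S T U : 'M[C]_(m, n)) :
  mxdot (S + T) U = mxdot S U + mxdot T U.
Proof. by rewrite -mxdotC mxdotDr rmorphD /= !mxdotC. Qed.

Lemma mxdotZl m n (S T : 'M[C]_(m, n)) a :
  mxdot (a *: S) T = a^* * mxdot S T.
Proof. by rewrite -mxdotC mxdotZr rmorphM /= mxdotC. Qed.

Lemma mxdot1 n (T : 'M[C]_n) : mxdot 1%:M T = \tr T.
Proof. by rewrite /mxdot trmx1 map_mx1 mul1mx. Qed.

Lemma fro_ge0 m n (T : 'M[C]_(m, n)) : 0 <= fro T.
Proof. by rewrite froE !sumr_ge0 // => i _; rewrite sumr_ge0 // => j _;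
  exact: exprn_ge0. Qed.

Lemma froZ m n (T : 'M[C]_(m, n)) a : fro (a *: T) = `|a| ^+ 2 * fro T.
Proof. by rewrite /fro mxdotZr mxdotZl normCK mulrA. Qed.

Lemma fro_eq0 m n (T : 'M[C]_(m, n)) : (fro T == 0) = (T == 0).
Proof.
apply/eqP/eqP => [|->]; last first.
  by rewrite froE big1 // => i _; rewrite big1 // => j _;
    rewrite mxE normr0 expr0n.
rewrite froE => T0; apply/matrixP => i j; rewrite mxE.
have ge0 k l : 0 <= `|T k l| ^+ 2 by exact: exprn_ge0.
have /psumr_eq0P H := T0; have := H _ i isT => {H}.
move=> /(_ (fun k _ => sumr_ge0 _ (fun l _ => ge0 k l))) /psumr_eq0P H.
have /eqP := H (fun l _ => ge0 i l) j isT.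
by rewrite sqrf_eq0 normr_eq0 => /eqP.
Qed.

Lemma fro_gt0 m n (T : 'M[C]_(m, n)) : (0 < fro T) = (T != 0).
Proof. by rewrite lt0r fro_ge0 fro_eq0 andbT. Qed.

Lemma fro_mul m n (T : 'M[C]_(m, n)) (x : 'cV_n) :
  fro (T *m x) = mxdot x (T^t* *m T *m x).
Proof. by rewrite /fro /mxdot trmx_mul map_mxM !mulmxA. Qed.

Lemma fro_unitary n (P : 'M[C]_n) (x : 'cV_n) :
  P \is unitarymx -> fro (P *m x) = fro x.
Proof.
rewrite -trmxC_unitary => /unitarymxP; rewrite trmxCK => PP.
by rewrite fro_mul PP mul1mx.
Qed.

Lemma fro_delta n (i : 'I_n) : fro (delta_mx i 0 : 'cV[C]_n) = 1.
Proof.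
rewrite froE (bigD1 i) //= big_ord1 mxE !eqxx normr1 expr1n big1 ?addr0 // => j
  ji.
by rewrite big_ord1 mxE (negPf ji) normr0 expr0n.
Qed.

(** Encodes [s] as the square of the spectral norm, attained at an eigenvector and bounding the
    quadratic form. Neither a supremum nor a square root occurs, so that it makes sense over any
    [numClosedFieldType]. *)
Definition is_sqnorm n (T : 'M[C]_n) (s : C) :=
  (exists2 v : 'cV_n, v != 0 & T^t* *m T *m v = s *: v) /\
  forall x : 'cV_n, fro (T *m x) <= s * fro x.

(** The spectral theorem diagonalizes [T^t* *m T] with nonnegative entries: the largest entry is the
    witness, and their sum is [fro T]. *)
Lemma ex_sqnorm_le_fro n (T : 'M[C]_n.+1) :
  exists2 s, is_sqnorm T s & s <= fro T.
Proof.
have normH : T^t* *m T \is normalmx.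
  by apply/normalmxP; rewrite trmx_mul map_mxM trmxCK.
have /orthomx_spectralP := normH.
set H := T^t* *m T; set P := spectralmx _; set d := spectral_diag _ => HE.
have uP : P \is unitarymx by exact: spectral_unitarymx.
rewrite invmx_unitary // in HE.
have PP : P *m P^t* = 1%:M by exact/unitarymxP.
have PP' : P^t* *m P = 1%:M by apply/mulmx1C.
have froT (x : 'cV_n.+1) : fro (T *m x) = \sum_i d 0 i * `|(P *m x) i 0| ^+ 2.
  rewrite fro_mul -/H HE /mxdot !mulmxA -map_mxM -trmx_mul -!mulmxA.
  set y := P *m x; rewrite /mxtrace big_ord1 mxE; apply: eq_bigr => i _.
  by rewrite mul_diag_mx !mxE normCK; ring.
have colE i : T^t* *m T *m (P^t* *m delta_mx i 0) = d 0 i *: (P^t* *m delta_mx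
  i 0 : 'cV_n.+1).
  rewrite -/H HE -!mulmxA (mulmxA P) PP mul1mx scalemxAr; congr (_ *m _).
  by rewrite mul_diag_mx; apply/matrixP => k l; rewrite !mxE;
    case: eqP => [->|] //=; rewrite ?mulr0 //.
have froD i : fro (P^t* *m delta_mx i 0 : 'cV_n.+1) = 1.
  by rewrite fro_unitary ?trmxC_unitary // fro_delta.
have d_ge0 i : 0 <= d 0 i.
  by rewrite -[d 0 i]mulr1 -(froD i) -mxdotZr -colE -fro_mul fro_ge0.
have [i _ imax] := @real_arg_maxP _ _ ord0 predT (d 0) isT (fun i _ =>
  ger0_real (d_ge0 i)).
exists (d 0 i); first split; last 1 first.
- rewrite /fro /mxdot -/H HE -mulmxA mxtrace_mulC -mulmxA PP mulmx1.
  rewrite mxtrace_diag (bigD1 i) //= lerDl; exact: sumr_ge0.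
- exists (P^t* *m delta_mx i 0); last exact: colE.
  by rewrite -fro_gt0 froD ltr01.
move=> x; rewrite froT -(fro_unitary x uP) [X in _ * X]froE mulr_sumr.
by apply: ler_sum => j _; rewrite big_ord1 ler_wpM2r ?exprn_ge0 //; exact: imax.
Qed.

Lemma ex_sqnorm n (T : 'M[C]_n.+1) : exists s, is_sqnorm T s.
Proof. by have [s sT _] := ex_sqnorm_le_fro T; exists s. Qed.

Lemma sqnorm_ge0 n (T : 'M[C]_n) s : is_sqnorm T s -> 0 <= s.
Proof.
move=> [[v v0 Hv] _]; have v_gt0 : 0 < fro v by rewrite fro_gt0.
by rewrite -(pmulr_lge0 _ v_gt0) -mxdotZr -Hv -fro_mul fro_ge0.
Qed.

Lemma sqnorm_le n (T : 'M[C]_n) s t : is_sqnorm T s -> is_sqnorm T t -> s <= t.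
Proof.
move=> [[v v0 Hv] _] [_ /(_ v)]; rewrite fro_mul Hv mxdotZr ler_pM2r //.
by rewrite fro_gt0.
Qed.

Lemma sqnorm_uniq n (T : 'M[C]_n) s t : is_sqnorm T s -> is_sqnorm T t -> s = t.
Proof. by move=> Ts Tt; apply/eqP; rewrite eq_le !(@sqnorm_le _ T). Qed.

Lemma sqnorm_le_fro n (T : 'M[C]_n.+1) s : is_sqnorm T s -> s <= fro T.
Proof.
by have [t Tt tT] := ex_sqnorm_le_fro T => Ts; rewrite (sqnorm_uniq Ts Tt).
Qed.

Lemma sqnormZ n (T : 'M[C]_n) a s : is_sqnorm T s -> is_sqnorm (a *: T) (`|a|
  ^+ 2 * s).
Proof.
move=> [[v v0 Hv] Tle]; split; last first.
  by move=> x; rewrite -scalemxAl froZ -[leRHS]mulrA ler_wpM2l ?Tle ?exprn_ge0.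
have -> : (a *: T)^t* = a^* *: T^t*.
  by apply/matrixP => i j; rewrite !mxE rmorphM.
exists v => //; rewrite -scalemxAl -scalemxAr scalerA.
by rewrite -scalemxAl Hv scalerA normCK [a * _]mulrC.
Qed.

Lemma sqnorm_entry n (T : 'M[C]_n) s i j : is_sqnorm T s -> `|T i j| ^+ 2 <= s.
Proof.
move=> [_ /(_ (delta_mx j 0))]; rewrite -colE fro_delta mulr1; apply: le_trans;
  rewrite froE (bigD1 i) //= big_ord1 mxE lerDl.
by apply: sumr_ge0 => k _; rewrite big_ord1 exprn_ge0.
Qed.

Lemma sqnorm0 n (T : 'M[C]_n.+1) : is_sqnorm T 0 <-> T = 0.
Proof.
split=> [T0|->]; last first.
  have [s [[v v0 Hv] ?]] := ex_sqnorm (0 : 'M[C]_n.+1).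
  suff <- : s = 0 by split => //; exists v.
  move: Hv; rewrite mulmx0 mul0mx => /esym /eqP.
  by rewrite scaler_eq0 (negPf v0) orbF => /eqP.
apply/matrixP => i j; rewrite mxE; apply/eqP.
have := sqnorm_entry i j T0; rewrite real_exprn_even_le0 //= ?normr_eq0 //.
exact: normr_real.
Qed.

End HilbertSchmidt.

(** * The real norms of the statement in terms of squared norms in [R[i]] *)

Section SpectralNorm.
Variable R : realType.
Local Notation C := R[i].
Local Open Scope complex_scope.

Lemma normcC (x : C) : (Normc.normc x)%:C = `|x|.
Proof. by case: x. Qed.

Lemma vnorm_fro n (x : 'cV[C]_n) : (vnorm x ^+ 2)%:C = fro x.
Proof.
rewrite /vnorm sqr_sqrtr; last by apply: sumr_ge0 => i _; exact: exprn_even_ge0.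
rewrite froE rmorph_sum; apply: eq_bigr => i _.
by rewrite big_ord1 rmorphXn /= normcC.
Qed.

Lemma frobnorm_fro m n (T : 'M[C]_(m, n)) : (frobnorm T ^+ 2)%:C = fro T.
Proof.
rewrite /frobnorm sqr_sqrtr; last first.
  by apply: sumr_ge0 => i _; apply: sumr_ge0 => j _; exact: exprn_even_ge0.
rewrite froE rmorph_sum; apply: eq_bigr => i _; rewrite rmorph_sum.
by apply: eq_bigr => j _; rewrite rmorphXn /= normcC.
Qed.

(** The normalized eigenvector maximizes the quantity under the supremum, so the supremum is
    attained. Nonnegativity is recorded in order to cancel squares in [specnorm_eq]. *)
Lemma specnorm_sqnorm n (T : 'M[C]_n.+1) s :
  is_sqnorm T s -> s = (specnorm T ^+ 2)%:C /\ 0 <= specnorm T.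
Proof.
move=> [[v v0 Hv] Tle].
have v_gt0 : 0 < fro v by rewrite fro_gt0.
have s_ge0 : 0 <= s.
  by rewrite -(pmulr_lge0 _ v_gt0) -mxdotZr -Hv -fro_mul fro_ge0.
have [k sE] : exists k, s = k%:C by apply/complex_realP/ger0_real.
have k_ge0 : 0 <= k by rewrite -lecR -sE.
have vn_ge0 m (x : 'cV[C]_m) : 0 <= vnorm x by exact: sqrtr_ge0.
have vn_gt0 : 0 < vnorm v.
  rewrite lt0r vn_ge0 andbT; apply/eqP => v00; move: v_gt0.
  by rewrite -vnorm_fro v00 expr0n ltxx.
suff -> : specnorm T = Num.sqrt k by rewrite sqr_sqrtr // sqrtr_ge0.
have ub (y : R) : [set vnorm (T *m x) | x in [set x : 'cV[C]_n.+1 | vnorm x =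
  1]]%classic y -> y <= Num.sqrt k.
  move=> [x /= x1 <-]; rewrite -(ger0_norm (vn_ge0 _ _)) -sqrtr_sqr ler_wsqrtr
    //.
  by rewrite -lecR vnorm_fro -sE (le_trans (Tle x)) // -vnorm_fro x1 expr1n
    mulr1.
pose w := (vnorm v)^-1%:C *: v.
have w1 : vnorm w = 1.
  apply/eqP; rewrite -(eqrXn2 (n := 2)) // expr1n -(inj_eq (@complexI R)).
  rewrite vnorm_fro froZ -vnorm_fro -normcC /= expr0n /= addr0 sqrtr_sqr.
  rewrite -rmorphXn -rmorphM /= real_normK ?num_real // -exprMn mulVf ?expr1n
    //; exact: lt0r_neq0.
have Tw : vnorm (T *m w) = Num.sqrt k.
  rewrite -[LHS]ger0_norm // -sqrtr_sqr; congr (Num.sqrt _).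
  apply: complexI; rewrite vnorm_fro fro_mul -scalemxAr Hv scalerA mulrC
    -scalerA.
  by rewrite mxdotZr -/(fro w) -vnorm_fro w1 expr1n mulr1.
apply/eqP; rewrite eq_le; apply/andP; split.
  by apply: ge_sup; [exists (vnorm (T *m w)), w | exact: ub].
rewrite -Tw; apply: ub_le_sup; last by exists w.
by exists (Num.sqrt k) => y; exact: ub.
Qed.

Lemma specnormP n (T : 'M[C]_n.+1) : is_sqnorm T (specnorm T ^+ 2)%:C.
Proof. by have [s sT] := ex_sqnorm T; have [<-] := specnorm_sqnorm sT. Qed.

Lemma sqnorm_specnorm n (S T : 'M[C]_n.+1) s :
  specnorm S = specnorm T -> is_sqnorm S s -> is_sqnorm T s.
Proof. by move=> ST Ss; rewrite (sqnorm_uniq Ss (specnormP S)) ST;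
  exact: specnormP. Qed.

Lemma specnorm_eq n (S T : 'M[C]_n.+1) s :
  is_sqnorm S s -> is_sqnorm T s -> specnorm S = specnorm T.
Proof.
move=> /specnorm_sqnorm [-> S0] /specnorm_sqnorm [ST T0].
by apply: (@pexpIrn _ 2 isT _ _ _ _ (complexI ST)); rewrite nnegrE.
Qed.

End SpectralNorm.

(** * Adjugates and singular values of 3x3 matrices *)

Section Matrix3.
Variable F : comNzRingType.
Implicit Types M N : 'M[F]_3.

(** Entries indexed by natural numbers reduce by computation once sums are unrolled, so [ring] sees
    equal entries as the same atom. *)
Lemma matrix_of_nat m n (M : 'M[F]_(m.+1, n.+1)) :
  exists f : nat -> nat -> F, M = \matrix_(i, j) f i j.
Proof.
exists (fun i j => M (inord i) (inord j)).
by apply/matrixP => i j; rewrite mxE !inord_val.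
Qed.


Lemma det_mx22E (f : nat -> nat -> F) :
  \det (\matrix_(i < 2, j < 2) f i j : 'M[F]_2) =
  f 0%N 0%N * f 1%N 1%N - f 0%N 1%N * f 1%N 0%N.
Proof.
rewrite (expand_det_row _ ord0) !big_ord_recl big_ord0 /cofactor !det_mx11 !mxE
  /=.
rewrite /bump /= !addn0 expr0 expr1; ring.
Qed.

Lemma adj_mx33E (f : nat -> nat -> F) (i j : 'I_3) :
  \adj (\matrix_(i < 3, j < 3) f i j : 'M[F]_3) i j =
  (if odd (j + i) then -1 else 1) * (f (bump j 0) (bump i 0) * f (bump j 1)
    (bump i 1)
                     - f (bump j 0) (bump i 1) * f (bump j 1) (bump i 0)).
Proof.
rewrite mxE /cofactor -signr_odd (fun_if (GRing.exp (-1))) expr1 expr0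
  -(det_mx22E (fun k l => f (bump j k) (bump i l))).
congr (_ * \det _); apply/matrixP => k l; by rewrite !mxE.
Qed.

Lemma det_mx33E (f : nat -> nat -> F) :
  \det (\matrix_(i < 3, j < 3) f i j : 'M[F]_3) =
  f 0%N 0%N * (f 1%N 1%N * f 2%N 2%N - f 1%N 2%N * f 2%N 1%N)
  - f 0%N 1%N * (f 1%N 0%N * f 2%N 2%N - f 1%N 2%N * f 2%N 0%N)
  + f 0%N 2%N * (f 1%N 0%N * f 2%N 1%N - f 1%N 1%N * f 2%N 0%N).
Proof.
set M := \matrix_(_, _) _.
have -> : \det M = (M *m \adj M) ord0 ord0 by rewrite mul_mx_adj mxE eqxx.
rewrite mxE !big_ord_recl big_ord0 /M !adj_mx33E !mxE /bump /= !add0n; ring.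
Qed.

Lemma tr_mx33E (f : nat -> nat -> F) :
  \tr (\matrix_(i < 3, j < 3) f i j : 'M[F]_3) = f 0%N 0%N + f 1%N 1%N + f 2%N
    2%N.
Proof. by rewrite /mxtrace !big_ord_recl big_ord0 !mxE /bump /= addr0 addrA.
  Qed.

Lemma tr_adj_mx33E (f : nat -> nat -> F) :
  \tr (\adj (\matrix_(i < 3, j < 3) f i j : 'M[F]_3)) =
  (f 1%N 1%N * f 2%N 2%N - f 1%N 2%N * f 2%N 1%N) +
  (f 0%N 0%N * f 2%N 2%N - f 0%N 2%N * f 2%N 0%N) +
  (f 0%N 0%N * f 1%N 1%N - f 0%N 1%N * f 1%N 0%N).
Proof.
by rewrite /mxtrace !big_ord_recl big_ord0 !adj_mx33E /bump /= addr0 !mul1r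
  addrA.
Qed.

Lemma char_polyE3 M t : \det (t%:M - M) =
  t ^+ 3 - \tr M * t ^+ 2 + \tr (\adj M) * t - \det M.
Proof.
have [f ->] := matrix_of_nat M.
have -> : t%:M - \matrix_(i < 3, j < 3) f i j = \matrix_(i < 3, j < 3) (t *+ (i
  == j :> nat) - f i j).
  by apply/matrixP => i j; rewrite !mxE.
rewrite (det_mx33E (fun i j => t *+ (i == j) - f i j)) det_mx33E tr_mx33E
  tr_adj_mx33E /=.
rewrite ?mulr1n ?mulr0n ?add0n ?addn0 ?add1n; ring.
Qed.

(** Cayley-Hamilton divided by [M]. It makes the adjugate of a polynomial in a matrix again such a
    polynomial. *)
Lemma adjE3 M : \adj M = M *m M - \tr M *: M + (\tr (\adj M))%:M.
Proof.
have [f ->] := matrix_of_nat M; apply/matrixP => i j.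
rewrite adj_mx33E tr_mx33E tr_adj_mx33E !mxE !big_ord_recl !big_ord0 !mxE /bump.
case: i j => -[|[|[|//]]] i [[|[|[|//]]] j] /=;
  rewrite -?val_eqE /= ?add0n ?addn0 ?add1n ?mulr1n ?mulr0n; ring.
Qed.

(** Newton's identity between the second elementary symmetric function and the power sums of the
    eigenvalues; the factor 2 stays because the ring need not allow division. *)
Lemma double_tr_adj M : 2 * \tr (\adj M) = \tr M ^+ 2 - \tr (M *m M).
Proof.
have := congr1 mxtrace (adjE3 M);
  rewrite mxtraceD raddfB /= mxtraceZ mxtrace_scalar.
set e := \tr (\adj M) => E.
have -> : \tr (M *m M) = e - e *+ 3 + \tr M * \tr M by rewrite {1}E; ring.
ring.
Qed.

(** The adjugate reverses products and the trace is cyclic. Taken at [T^t*] and [T], it turns the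
    middle coefficient of the cubic into [fro (\adj T)]. *)
Lemma tr_adjM3 M N : \tr (\adj (M *m N)) = \tr (\adj M *m \adj N).
Proof.
have [f ->] := matrix_of_nat M; have [g ->] := matrix_of_nat N.
have -> : \matrix_(i < 3, j < 3) f i j *m \matrix_(i < 3, j < 3) g i j =
  \matrix_(i < 3, j < 3) (f i 0%N * g 0%N j + f i 1%N * g 1%N j + f i 2%N * g
    2%N j).
  by apply/matrixP => i j; rewrite !mxE !big_ord_recl !big_ord0 !mxE /bump /=
    addr0 addrA.
rewrite (tr_adj_mx33E (fun i j => f i 0%N * g 0%N j + f i 1%N * g 1%N j + f i
  2%N * g 2%N j)).
rewrite /mxtrace !big_ord_recl big_ord0 [X in _ = X + _]mxE [X in _ = _ + (X +
  _)]mxE.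
rewrite [X in _ = _ + (_ + (X + _))]mxE !big_ord_recl !big_ord0 !adj_mx33E
  /bump /=.
rewrite ?add0n ?addn0 ?add1n; ring.
Qed.

End Matrix3.

Section SingularCubic.
Variable C : numClosedFieldType.
Implicit Types S T : 'M[C]_3.

Definition svcubic T (t : C) :=
  t ^+ 3 - fro T * t ^+ 2 + fro (\adj T) * t - `|\det T| ^+ 2.

Lemma svcubicE T t : \det (t%:M - T^t* *m T) = svcubic T t.
Proof.
rewrite char_polyE3 tr_adjM3 det_mulmx -map_mx_adj -trmx_adj det_map_mx det_tr.
by rewrite /svcubic normCK [X in _ - X]mulrC.
Qed.

Lemma sqnorm_root T s : is_sqnorm T s -> svcubic T s = 0.
Proof.
move=> [[v v0 Hv] _]; rewrite -svcubicE -det_tr; apply/eqP/det0P.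
(* [det0P] provides a row vector killed from the left, hence the passage to the transpose. *)
exists v^T; first by rewrite trmx_eq0.
by rewrite -trmx_mul mulmxBl mul_scalar_mx Hv subrr trmx0.
Qed.

Lemma sqnorm_max T s t : is_sqnorm T s -> svcubic T t = 0 -> t <= s.
Proof.
move=> [_ Tle] /eqP; rewrite -svcubicE -det_tr => /det0P [v v0 Hv].
have vT : 0 < fro v^T by rewrite fro_gt0 trmx_eq0.
rewrite -(ler_pM2r vT) (le_trans _ (Tle _)) // fro_mul.
move/(congr1 trmx): Hv; rewrite trmx0 trmx_mul trmxK mulmxBl mul_scalar_mx.
by move/eqP; rewrite subr_eq0 => /eqP <-; rewrite mxdotZr.
Qed.

Lemma sqnorm_eq_svcubic S T s t : svcubic S =1 svcubic T ->
  is_sqnorm S s -> is_sqnorm T t -> s = t.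
Proof.
move=> ST Ss Tt; apply/eqP; rewrite eq_le (sqnorm_max Tt) ?(sqnorm_max Ss) //.
  by rewrite ST sqnorm_root.
by rewrite -ST sqnorm_root.
Qed.

End SingularCubic.

(** * Polynomials of degree one in a matrix of rank at most one *)

Section RankOne.
Variables (C : numClosedFieldType) (N : 'M[C]_3) (tau : C).
Hypotheses (NN : N *m N = tau *: N) (trN : \tr N = tau).

Lemma tr_adj_rank1 : \tr (\adj N) = 0.
Proof.
apply: (mulfI (_ : 2 != 0)); first by rewrite pnatr_eq0.
by rewrite mulr0 double_tr_adj NN mxtraceZ trN expr2 subrr.
Qed.

(** Here the two hypotheses reveal their meaning: all minors of size two vanish, so [N] has rank at
    most one. *)
Lemma adj_rank1 : \adj N = 0.
Proof. by rewrite adjE3 NN trN subrr add0r tr_adj_rank1 raddf0. Qed.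

Lemma det_rank1 : \det N = 0.
Proof.
have /matrixP/(_ 0 0) := mul_mx_adj N.
by rewrite adj_rank1 mulmx0 !mxE eqxx mulr1n.
Qed.

(** The squared departure from normality in the sense of Henrici, since the eigenvalues of [N] are
    [tau], 0 and 0. *)
Definition defect : C := fro N - `|tau| ^+ 2.

(** A nonzero column of [N] is an eigenvector for [tau], so the squared norm [s] is at least
    [|tau|^2]; and the cubic of [N] is [t^2 (t - fro N)], so [s] is 0 or [fro N]. *)
Lemma defect_ge0 : 0 <= defect.
Proof.
rewrite subr_ge0; have [s sN] := ex_sqnorm N.
have taus : `|tau| ^+ 2 <= s.
  have [N0|] := eqVneq N 0.
    by rewrite -trN N0 mxtrace0 normr0 expr0n (sqnorm_ge0 sN).
  rewrite -fro_gt0 froE => N0.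
  have [j Nj] : exists j, col j N != 0.
    apply/existsP; apply/contraLR: N0; rewrite negb_exists => /forallP Nj.
    rewrite big1 ?ltxx // => i _; rewrite big1 // => j _.
    move/negPn/eqP/colP/(_ i): (Nj j); rewrite !mxE => ->.
    by rewrite normr0 expr0n.
  rewrite -fro_gt0 in Nj; have := sN.2 (col j N).
  by rewrite {1}colE mulmxA NN -scalemxAl -colE froZ ler_pM2r.
have : s ^+ 2 * (s - fro N) = 0.
  by have := sqnorm_root sN; rewrite /svcubic det_rank1 adj_rank1 normr0 => <-;
    rewrite /fro /mxdot mulmx0 mxtrace0; ring.
move/eqP; rewrite mulf_eq0 sqrf_eq0 subr_eq0 => /orP[] /eqP sE.
  by rewrite (le_trans taus) // sE fro_ge0.
by rewrite -sE.
Qed.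

Variables (a b : C).
Let T := a%:M + b *: N.
Let x := `|a| ^+ 2.
Let y := `|a + b * tau| ^+ 2.
Let k := `|b| ^+ 2 * defect.

Definition svquad (t : C) := t ^+ 2 - (x + y + k) * t + x * y.

Lemma fro_scalarD (c d : C) :
  fro (c%:M + d *: N) = 3 * `|c| ^+ 2 + (c^* * d * tau + c * d^* * tau^*) +
    `|d| ^+ 2 * fro N.
Proof.
rewrite -[c%:M]scalemx1 /fro !(mxdotDl, mxdotDr, mxdotZl, mxdotZr).
by rewrite -(mxdotC 1%:M N) !mxdot1 mxtrace1 trN !normCK; ring.
Qed.

(** The square and the adjugate of [T] stay in the span of [1] and [N], so every coefficient of the
    cubic is a function of [a], [b], [tau] and [fro N]. *)
Lemma svcubic_rank1 t : svcubic T t = (t - x) * svquad t.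
Proof.
have TT : T *m T = (a ^+ 2)%:M + (2 * a * b + b ^+ 2 * tau) *: N.
  rewrite /T mulmxDl !mulmxDr !mul_scalar_mx !mul_mx_scalar -scalemxAr
    -scalemxAl NN.
  rewrite !scalerA scale_scalar_mx -addrA -!scalerDl addrA; congr (_ + _ *: _);
    ring.
have trT : \tr T = 3 * a + b * tau.
  by rewrite mxtraceD mxtraceZ mxtrace_scalar trN; ring.
have trA : \tr (\adj T) = 3 * a ^+ 2 + 2 * a * b * tau.
  apply: (mulfI (_ : 2 != 0)); first by rewrite pnatr_eq0.
  rewrite double_tr_adj TT trT mxtraceD mxtraceZ mxtrace_scalar trN; ring.
have adjT : \adj T = a *: ((a + b * tau)%:M + (- b) *: N).
  rewrite adjE3 trA trT TT /T; apply/matrixP => i j; rewrite !mxE; ring.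
have detT : \det T = a ^+ 2 * (a + b * tau).
  have -> : T = a%:M - (- b) *: N by rewrite scaleNr opprK.
  rewrite char_polyE3 detZ det_rank1 mxtraceZ trN adjZ mxtraceZ tr_adj_rank1.
  ring.
rewrite /svcubic /svquad detT adjT froZ !fro_scalarD /x /y /k /defect.
rewrite !normCK !rmorphM !rmorphD !rmorphN !rmorphM /=; ring.
Qed.

(** The value of [svquad] at [x] is [- k x], which is at most 0, so [x] lies below the larger root
    [r] of [svquad]. The split factor therefore never carries the maximum alone. *)
Lemma svquad_sqnorm s : is_sqnorm T s ->
  svquad s = 0 /\ forall t, svquad t = 0 -> t <= s.
Proof.
move=> sT.
have qmax t : svquad t = 0 -> t <= s.
  by move=> qt; apply: (sqnorm_max sT); rewrite svcubic_rank1 qt mulr0.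
split=> //.
have := sqnorm_root sT; rewrite svcubic_rank1 => /eqP.
rewrite mulf_eq0 subr_eq0 => /orP[/eqP sx|/eqP //].
have x0 : 0 <= x by exact: exprn_ge0.
have y0 : 0 <= y by exact: exprn_ge0.
have k0 : 0 <= k by rewrite mulr_ge0 ?exprn_ge0 ?defect_ge0.
(* [D] is the discriminant of [svquad], written as a sum of two nonnegative terms, so that [|w|] is
   visibly at most its square root. *)
pose w := y + k - x; pose D := w ^+ 2 + 4 * k * x.
have wR : w \is Num.real by rewrite rpredB ?rpredD ?ger0_real.
pose r := (x + y + k + sqrtC D) / 2.
have qr : svquad r = 0.
  have := sqrtCK D; rewrite /svquad /r; set d := sqrtC D => dD.
  have -> : ((x + y + k + d) / 2) ^+ 2 - (x + y + k) * ((x + y + k + d) / 2) +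
    x * y = (d ^+ 2 - (x + y + k) ^+ 2 + 4 * x * y) / 4 by field.
  by rewrite dD /D /w; field.
have xr : x <= r.
  rewrite ler_pdivlMr ?ltr0n // -subr_ge0.
  have -> : x + y + k + sqrtC D - x * 2 = w + sqrtC D by rewrite /w; ring.
  have kx : 0 <= 4 * k * x by apply: mulr_ge0 => //; apply: mulr_ge0 => //;
    exact: ler0n.
  have wD : `|w| <= sqrtC D.
    rewrite -(sqrCK (normr_ge0 w)) ler_sqrtC ?nnegrE ?exprn_ge0 //.
      by rewrite real_normK // lerDl.
    by apply: addr_ge0 => //; rewrite real_exprn_even_ge0.
  by rewrite -lerBlDl sub0r (le_trans _ wD) // -normrN real_ler_norm ?rpredN.
have rs : r = s by apply/eqP; rewrite eq_le qmax //= sx.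
by rewrite -rs.
Qed.

End RankOne.

(** * Resolvents and minimal polynomials *)

(** Stands in for density: from a sequence all of whose terms would serve, it picks one that avoids
    finitely many exceptional points. *)
Lemma injective_nonroot (F : idomainType) (h : {poly F}) (f : nat -> F) :
  h != 0 -> injective f -> exists k, ~~ root h (f k).
Proof.
move=> h0 fI.
have [/allP|] := boolP (all (root h) [seq f k | k <- iota 0 (size h)]).
  move=> /allP /(max_poly_roots h0); rewrite map_inj_uniq // iota_uniq.
  by rewrite size_map size_iota ltnn => /(_ isT).
by case/allPn => _ /mapP [k _ ->] hk; exists k.
Qed.

Lemma nat_nonroot (F : numDomainType) (h : {poly F}) :
  h != 0 -> exists k, ~~ root h k%:R.
Proof.
move=> h0; apply: (injective_nonroot (f := fun j => j%:R)) => // i j /eqP.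
by rewrite eqr_nat => /eqP.
Qed.

Section NearRoot.
Variable C : numFieldType.

Lemma poly_bounded_ball (p : {poly C}) z0 :
  exists2 K, 0 <= K & forall z, `|z - z0| <= 1 -> `|p.[z]| <= K.
Proof.
elim/poly_ind: p => [|p c [K K0 pK]]; first by exists 0 => // z _;
  rewrite horner0 normr0.
exists (K * (1 + `|z0|) + `|c|); first by rewrite addr_ge0 ?mulr_ge0 ?addr_ge0.
move=> z zz; rewrite hornerMXaddC (le_trans (ler_normD _ _)) // lerD2r normrM.
rewrite ler_pM ?pK // -[z in leLHS](subrK z0) (le_trans (ler_normD _ _)) //.
by rewrite lerD2r.
Qed.

(** Continuity at [z0] without limits: [p.[z0]] differs from [p.[z]] by a bounded multiple of
    [z - z0], and [h] excludes the points where the estimate is unknown. *)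
Lemma root_of_le_dist (p h : {poly C}) z0 K : h != 0 -> 0 <= K ->
  (forall z, ~~ root h z -> `|z - z0| <= 1 -> `|p.[z]| <= K * `|z - z0|) ->
  root p z0.
Proof.
move=> h0 K0 pK; apply/eqP.
have [q qE] : exists q, p - (p.[z0])%:P = q * ('X - z0%:P).
  by apply/factor_theorem; rewrite /root !hornerE subrr.
have [L L0 qL] := poly_bounded_ball q z0.
set w := p.[z0] in qE *; apply/eqP; apply: contraT => w0.
have w_gt0 : 0 < `|w| by rewrite normr_gt0.
have KL0 : 0 <= K + L by rewrite addr_ge0.
have d_gt0 : 0 < `|w| + (K + L) by rewrite ltr_wpDr.
(* This radius is at most 1 and satisfies [e (K + L) < |w|], also when [K + L = 0]. *)
pose e := `|w| / (`|w| + (K + L)).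
have e_gt0 : 0 < e by rewrite divr_gt0.
have e_le1 : e <= 1 by rewrite ler_pdivrMr // mul1r lerDl.
pose f k := z0 + e / k.+1%:R.
have fI : injective f.
  move=> i j /addrI /(mulfI (lt0r_neq0 e_gt0)) /invr_inj /eqP.
  by rewrite eqr_nat eqSS => /eqP.
have [k hk] := injective_nonroot h0 fI.
have fk : `|f k - z0| <= e.
  rewrite /f addrC addKr normrM normfV normr_nat gtr0_norm //.
  by rewrite ler_pdivrMr ?ltr0n // ler_peMr ?ler1n // ltW.
have fk1 := le_trans fk e_le1.
have : `|w| <= e * (K + L).
  have -> : w = p.[f k] - q.[f k] * (f k - z0).
    have /(congr1 (horner^~ (f k))) := qE; rewrite !hornerE => <-.
    by rewrite opprB addrC subrK.
  rewrite (le_trans (ler_normB _ _)) // normrM.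
  apply: (@le_trans _ _ (`|f k - z0| * (K + L))); last exact: ler_wpM2r.
  by rewrite mulrDr lerD ?[`|f k - z0| * _]mulrC ?pK // ler_wpM2r ?qL.
by rewrite /e mulrAC ler_pdivlMr // ler_pM2l // gerDr => /le_gtF; rewrite w_gt0.
Qed.

End NearRoot.

Section ResolventPolynomial.
Variables (F : fieldType) (n : nat).
Implicit Types (A : 'M[F]_n.+1) (m : {poly F}) (z : F).

(** The difference quotient of [m] at [z]. If [m] annihilates [A], its value at [A] is [m(z)] times
    the resolvent. *)
Definition rpoly m z := (m - (m.[z])%:P) %/ ('X - z%:P).

Lemma rpolyE m z : rpoly m z * ('X - z%:P) = m - (m.[z])%:P.
Proof. by rewrite divpK // dvdp_XsubCl /root !hornerE subrr. Qed.

Lemma rpoly_cons m z c : rpoly (m * 'X + c%:P) z = rpoly m z * 'X + (m.[z])%:P.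
Proof.
apply: (mulIf (_ : 'X - z%:P != 0)); first by rewrite polyXsubC_eq0.
rewrite rpolyE mulrDl mulrAC rpolyE !hornerE.
by rewrite polyCD polyCM; ring.
Qed.

Lemma mul_rpoly A m z : horner_mx A m = 0 ->
  (z%:M - A) *m horner_mx A (rpoly m z) = (m.[z])%:M.
Proof.
move=> mA; have := congr1 (horner_mx A) (rpolyE m z).
rewrite mulrC rmorphM !rmorphB /= mA sub0r horner_mx_X !horner_mx_C => E.
by apply: oppr_inj; rewrite -E -mulNmx opprB.
Qed.

Lemma unitmx_mxminpoly A z : (z%:M - A \in unitmx) = ~~ root (mxminpoly A) z.
Proof.
rewrite root_mxminpoly -eigenvalue_root_char /eigenvalue /eigenspace negbK
  kermx_eq0.
by rewrite row_free_unit -opprB -[LHS]/(_ \is a GRing.unit) unitrN.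
Qed.

Lemma invmx_rpoly A m z : horner_mx A m = 0 -> ~~ root m z ->
  invmx (z%:M - A) = (m.[z])^-1 *: horner_mx A (rpoly m z).
Proof.
move=> mA mz; have H := mul_rpoly z mA.
have E : (z%:M - A) *m ((m.[z])^-1 *: horner_mx A (rpoly m z)) = 1%:M.
  by rewrite -scalemxAr H scale_scalar_mx mulVf.
have [U _] := mulmx1_unit E.
by rewrite -[RHS]mul1mx -(mulVmx U) -mulmxA E mulmx1.
Qed.

(** The numerator of the resolvent depends polynomially on [z], so it may be evaluated at the poles
    too. [rpoly_cons] drives the induction. *)
Lemma horner_rpoly_mx A m : exists Q : 'M[{poly F}]_n.+1,
  forall z, horner_mx A (rpoly m z) = map_mx (horner_eval z) Q.
Proof.
elim/poly_ind: m => [|m c [Q QE]].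
  by exists 0 => z; rewrite /rpoly horner0 subrr div0p rmorph0 map_mx0.
exists (Q *m map_mx polyC A + m%:M) => z.
rewrite rpoly_cons rmorphD rmorphM /= horner_mx_X horner_mx_C QE map_mxD
  map_mxM.
rewrite map_scalar_mx -map_mx_comp; congr (_ *m _ + _).
by apply/matrixP => i j; rewrite !mxE /= /horner_eval hornerC.
Qed.

(** The difference quotient has smaller degree than the minimal polynomial, so it cannot annihilate
    [A], not even at an eigenvalue [z]. *)
Lemma horner_rpoly_neq0 A z : horner_mx A (rpoly (mxminpoly A) z) != 0.
Proof.
set m := mxminpoly A; have sm : (1 < size m)%N.
  by rewrite size_mxminpoly ltnS mxminpoly_nonconstant.
have E := rpolyE m z; apply/eqP => /mxminpoly_min mr.
have r0 : rpoly m z != 0.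
  apply: contraTneq sm => r0; move: E; rewrite r0 mul0r => /esym/eqP.
  by rewrite subr_eq0 => /eqP ->; rewrite -leqNgt size_polyC_leq1.
have := dvdp_leq r0 mr; rewrite -/m leqNgt -ltnS => /negP []; rewrite ltnS.
have := congr1 (size : {poly F} -> nat) E; rewrite size_Mmonic ?monicXsubC //.
rewrite size_XsubC addn2 /= => ->.
rewrite (leq_trans (size_polyD _ _)) // geq_max leqnn size_polyN.
by rewrite (leq_trans (size_polyC_leq1 _)) // ltnW.
Qed.

End ResolventPolynomial.

(* At a zero of [m / gcdp m c] the inequality would force [Q] to vanish. *)
Lemma dvdp_of_le_fro (C : numClosedFieldType) n (m c : {poly C}) (Q S :
  'M[{poly C}]_n) :
  m != 0 -> (forall z, map_mx (horner_eval z) Q != 0) ->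
  (forall z i j, ~~ root m z ->
    `|c.[z]| ^+ 2 * `|(Q i j).[z]| ^+ 2 <=
    `|m.[z]| ^+ 2 * fro (map_mx (horner_eval z) S)) ->
  m %| c.
Proof.
move=> m0 Q0 QS; pose g := gcdp m c.
have g0 : g != 0 by rewrite gcdp_eq0 negb_and m0.
pose m' := m %/ g; pose c' := c %/ g.
have mE : m = m' * g by rewrite divpK // dvdp_gcdl.
have cE : c = c' * g by rewrite divpK // dvdp_gcdr.
have cop : coprimep m' c' by apply: coprimep_div_gcd; rewrite m0.
have [/eqP/size_poly1P [a a0 m'E]|] := eqVneq (size m') 1%N.
  by rewrite mE m'E mul_polyC dvdpZl // dvdp_gcdr.
move/closed_rootP => [z0 m'z0]; exfalso.
have c'z0 : ~~ root c' z0 by apply: (coprimep_root cop).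
have /eqP := Q0 z0; apply; apply/matrixP => i j; rewrite !mxE /horner_eval.
have [m'' m''E] : exists q, m' = q * ('X - z0%:P) by exact/factor_theorem.
suff : root (c' * Q i j) z0 by rewrite rootM (negPf c'z0) => /rootP.
(* [m''] is [m'] with one factor [X - z0] removed. After cancelling [|g(z)|^2], the bound becomes
   [fro U] times [|z - z0|^2], and [fro U] is bounded near [z0]. *)
pose U := \matrix_(k, l) (m'' * S k l).
have [K K0 UK] : exists2 K, 0 <= K & forall z, `|z - z0| <= 1 ->
    fro (map_mx (horner_eval z) U) <= K.
  have [K K0 KU] := fin_all_exists2 (fun kl => poly_bounded_ball (U kl.1 kl.2)
    z0).
  exists (\sum_k \sum_l K (k, l) ^+ 2).
    by apply: sumr_ge0 => k _; apply: sumr_ge0 => l _; rewrite exprn_ge0.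
  move=> z zz; rewrite froE; apply: ler_sum => k _; apply: ler_sum => l _.
  rewrite [X in `|X|]mxE /horner_eval.
  by apply: lerXn2r; rewrite ?nnegrE //; exact: (KU (k, l)).
apply: (@root_of_le_dist _ _ m z0 (sqrtC K)) => //; first by rewrite sqrtC_ge0.
move=> z mz zz.
rewrite -ler_sqr ?nnegrE ?mulr_ge0 ?sqrtC_ge0 // exprMn sqrtCK.
have gz : 0 < `|g.[z]| ^+ 2.
  rewrite exprn_gt0 // normr_gt0; apply: contraNneq mz => gz.
  by rewrite /root mE hornerM gz mulr0.
have := QS z i j mz; rewrite cE mE !hornerM !normrM !exprMn.
move: (`|g.[z]| ^+ 2) gz => G G0.
rewrite [leLHS]mulrAC [leRHS]mulrAC ler_pM2r // => /le_trans; apply.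
have -> : `|m'.[z]| ^+ 2 * fro (map_mx (horner_eval z) S) =
   fro (map_mx (horner_eval z) U) * `|z - z0| ^+ 2.
  have -> : map_mx (horner_eval z) U = m''.[z] *: map_mx (horner_eval z) S.
    by apply/matrixP => k l; rewrite !mxE /horner_eval hornerM.
  by rewrite froZ m''E hornerM hornerXsubC normrM exprMn; ring.
by rewrite ler_wpM2r ?exprn_ge0 ?UK.
Qed.

Lemma le_of_scaled_eq (C : numFieldType) (x y q s t f : C) :
  x != 0 -> y != 0 -> q <= s -> t <= f ->
  `|x^-1| ^+ 2 * s = `|y^-1| ^+ 2 * t -> `|y| ^+ 2 * q <= `|x| ^+ 2 * f.
Proof.
move=> x0 y0 qs tf; rewrite !normfV !exprVn => st.
have X0 : `|x| ^+ 2 != 0 by rewrite expf_neq0 // normr_eq0.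
have Y0 : `|y| ^+ 2 != 0 by rewrite expf_neq0 // normr_eq0.
apply: (@le_trans _ _ (`|y| ^+ 2 * s)); first by rewrite ler_wpM2l ?exprn_ge0.
rewrite -[s](mulKf X0) mulrCA mulrCA.
rewrite [_^-1 * _]mulrCA st (mulrCA (`|y| ^+ 2)) mulVKf //.
by rewrite ler_wpM2l ?exprn_ge0.
Qed.

(** * Either relation determines the minimal polynomial *)

Section MinimalPolynomial.
Variables (R : realType) (n : nat).
Local Notation C := R[i].
Implicit Types A B S T : 'M[C]_n.+1.

Lemma specnorm_scale S T (a : C) :
  specnorm S = specnorm T -> specnorm (a *: S) = specnorm (a *: T).
Proof.
move=> ST; have [s Ss] := ex_sqnorm S.
exact: specnorm_eq (sqnormZ a Ss) (sqnormZ a (sqnorm_specnorm ST Ss)).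
Qed.

Lemma specnorm_eq0 T : specnorm T = 0 <-> T = 0.
Proof.
rewrite -sqnorm0; split=> [T0|T0].
  by have := specnormP T; rewrite T0 expr0n.
have [/esym/eqP] := specnorm_sqnorm T0.
by rewrite -(rmorph0 (real_complex R)) (inj_eq (@complexI R)) sqrf_eq0 => /eqP.
Qed.

Lemma resolvent_normE A z : resolvent_norm A z =
  if root (mxminpoly A) z then +oo%E else
  (specnorm ((mxminpoly A).[z]^-1 *: horner_mx A (rpoly (mxminpoly A) z)))%:E%E.
Proof.
rewrite /resolvent_norm unitmx_mxminpoly; case: ifPn => mz;
  last by rewrite (negPn mz).
by rewrite (negPf mz) (invmx_rpoly (mx_root_minpoly A) mz).
Qed.

Lemma same_pseudospectra_minpolyE A B : mxminpoly A = mxminpoly B ->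
  same_pseudospectra A B <->
  (forall z, ~~ root (mxminpoly A) z ->
    specnorm (horner_mx A (rpoly (mxminpoly A) z)) =
    specnorm (horner_mx B (rpoly (mxminpoly A) z))).
Proof.
move=> mAB; split=> [AB z mz|AB z].
  have := AB z; rewrite (resolvent_normE A) (resolvent_normE B) -mAB (negPf mz)
    => E0; have E := @EFin_inj _ _ _ E0.
  have := specnorm_scale (mxminpoly A).[z] E.
  by rewrite 2!scalerA (mulfV mz) 2!scale1r.
rewrite (resolvent_normE A) (resolvent_normE B) -mAB.
have [mz|mz] := boolP (root (mxminpoly A) z); first by [].
by rewrite (specnorm_scale _ (AB z mz)).
Qed.

(** A polynomial annihilates a matrix exactly when its value has norm zero, so each minimal
    polynomial annihilates the other matrix. *)
Lemma poly_isometric_minpoly A B :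
  poly_isometric A B -> mxminpoly A = mxminpoly B.
Proof.
move=> AB; apply/eqP; rewrite -eqp_monic ?mxminpoly_monic // /eqp.
apply/andP; split; apply/mxminpoly_minP/specnorm_eq0.
  by rewrite (AB (mxminpoly B)) mx_root_minpoly; apply/specnorm_eq0.
by rewrite -(AB (mxminpoly A)) mx_root_minpoly; apply/specnorm_eq0.
Qed.

Lemma poly_isometric_same_pseudospectra A B :
  poly_isometric A B -> same_pseudospectra A B.
Proof.
move=> AB; apply/same_pseudospectra_minpolyE;
  first exact: poly_isometric_minpoly.
by move=> z _; exact: AB.
Qed.

(** The common squared norm is squeezed between an entry of the numerator for [A] and the Frobenius
    norm of the numerator for [B], which is the estimate needed by [dvdp_of_le_fro]. *)
Lemma same_pseudospectra_dvdp A B :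
  same_pseudospectra A B -> mxminpoly A %| mxminpoly B.
Proof.
move=> AB.
have ifE (b b' : bool) (s t : R) : (if b then +oo else s%:E)%E =
    (if b' then +oo else t%:E)%E -> ~~ b -> ~~ b' /\ s = t.
  by case: b b' => [] [] // [->].
have [Q QE] := horner_rpoly_mx A (mxminpoly A).
have [S SE] := horner_rpoly_mx B (mxminpoly B).
have Q0 z : map_mx (horner_eval z) Q != 0 by rewrite -QE;
  exact: horner_rpoly_neq0.
apply: (dvdp_of_le_fro _ Q0) => [|z i j mz];
  first exact/monic_neq0/mxminpoly_monic.
have := AB z; rewrite (resolvent_normE A) (resolvent_normE B).
move=> /ifE /(_ mz) [cz]; rewrite QE SE => E.
have [s sA] := ex_sqnorm (map_mx (horner_eval z) Q).
have [t tB] := ex_sqnorm (map_mx (horner_eval z) S).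
have st := sqnorm_uniq (sqnorm_specnorm E (sqnormZ _ sA)) (sqnormZ _ tB).
have tS := sqnorm_le_fro tB; have := sqnorm_entry i j sA.
rewrite [X in `|X|]mxE /horner_eval => Qs.
exact: le_of_scaled_eq mz cz Qs tS st.
Qed.

Lemma same_pseudospectra_minpoly A B :
  same_pseudospectra A B -> mxminpoly A = mxminpoly B.
Proof.
move=> AB; apply/eqP; rewrite -eqp_monic ?mxminpoly_monic // /eqp.
have BA : same_pseudospectra B A by move=> z; exact: esym (AB z).
apply/andP; split; [exact: same_pseudospectra_dvdp AB|].
exact: same_pseudospectra_dvdp BA.
Qed.

End MinimalPolynomial.

(** * Minimal polynomials of degree three *)

(** Polarization: testing [v + w] and [v + 'i *: w] separates the two mixed terms. *)
Lemma quadratic_form0 (C : numClosedFieldType) n (M : 'M[C]_n) :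
  (forall v : 'cV_n, mxdot v (M *m v) = 0) -> M = 0.
Proof.
move=> M0.
have Mvw (v w : 'cV_n) : mxdot v (M *m w) = 0.
  have := M0 (v + w); have := M0 (v + 'i *: w).
  rewrite !mulmxDr !(mxdotDl, mxdotDr) -!scalemxAr !(mxdotZl, mxdotZr) !M0
    conjCi.
  set x := mxdot v _; set y := mxdot w _ => E1 E2.
  have : 2 * 'i * x = 0.
    transitivity (0 + 'i * x + (- 'i * y + - 'i * ('i * 0)) + 'i * (0 + x + (y
      + 0))).
      ring.
    by rewrite E1 E2 mulr0 addr0.
  by move/eqP; rewrite !mulf_eq0 pnatr_eq0 (negPf (neq0Ci _)) => /eqP.
have M_col (j : 'I_n) : col j M = 0.
  by apply/eqP; rewrite -fro_eq0 colE /fro Mvw.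
by apply/matrixP => i j; have /colP/(_ i) := M_col j; rewrite !mxE.
Qed.

Lemma linear_bounded_off_roots (C : numClosedFieldType) (h : {poly C}) (u c :
  C) : h != 0 ->
  (forall z, ~~ root h z -> z^* * u + z * u^* <= c) -> u = 0.
Proof.
move=> h0 uc; apply/eqP; apply: contraT => u0.
have c1 : 0 < `|c| + 1 by rewrite ltr_wpDl.
have uu : 0 < u * u^* by rewrite mul_conjC_gt0.
(* With this scale the linear form takes the value [2 (|c| + 1) (k + 1)] at [l (k + 1) u], which
   exceeds [c] for every [k]; avoiding the roots of [h] then costs nothing. *)
pose l := (`|c| + 1) / (u * u^*).
have l0 : 0 < l by rewrite divr_gt0.
have lE : l * (u * u^*) = `|c| + 1 by rewrite divfK // lt0r_neq0.
clearbody l.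
have [k hk] : exists k, ~~ root h (l * k.+1%:R * u).
  apply: injective_nonroot => // i j /(mulIf u0) /(mulfI (lt0r_neq0 l0)) /eqP.
  by rewrite eqr_nat eqSS => /eqP.
have := uc _ hk; rewrite !rmorphM /= conjC_nat (geC0_conj (ltW l0)).
have -> : l * k.+1%:R * u^* * u + l * k.+1%:R * u * u^* =
  2 * (l * (u * u^*)) * k.+1%:R by ring.
rewrite lE => le_c.
have c0 : 0 <= c by rewrite (le_trans _ le_c) // !mulr_ge0 // ltW.
move: le_c; rewrite ger0_norm // => /(le_trans _) le_c.
have /le_c : 2 * (c + 1) <= 2 * (c + 1) * k.+1%:R.
  by rewrite ler_peMr ?ler1n // mulr_ge0 // addr_ge0.
rewrite mulrDr mulr1 mulr_natl mulr2n -addrA gerDl => /le_gtF.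
by rewrite ltr_wpDl.
Qed.

Section CharPoly3.
Variable F : fieldType.
Implicit Types A B : 'M[F]_3.

Lemma horner_char_poly n (A : 'M[F]_n) t : (char_poly A).[t] = \det (t%:M - A).
Proof.
rewrite -[LHS]/(horner_eval t _) -det_map_mx; congr (\det _).
apply/matrixP => i j; by rewrite !mxE /= /horner_eval hornerD hornerN hornerC
  hornerMn hornerX.
Qed.

Lemma char_poly_invariants A B : char_poly A = char_poly B ->
  [/\ \tr A = \tr B, \tr (\adj A) = \tr (\adj B) & \det A = \det B].
Proof.
move=> AB.
have trE : \tr A = \tr B by apply: oppr_inj; rewrite -!char_poly_trace // AB.
have detE : \det A = \det B.
  have := congr1 (fun p : {poly F} => p`_0) AB; rewrite !char_poly_det.
  by apply/mulfI; rewrite expf_neq0 // oppr_eq0 oner_eq0.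
split=> //; have := congr1 (horner^~ 1) AB.
rewrite !horner_char_poly !char_polyE3 trE detE expr1n !mulr1.
by move=> /addIr /addrI.
Qed.

Lemma horner_mx_mod n (A : 'M[F]_n.+1) m p : horner_mx A m = 0 ->
  horner_mx A p = horner_mx A (p %% m).
Proof. by move=> mA; rewrite {1}(divp_eq p m) rmorphD rmorphM /= mA mulr0
  add0r. Qed.

Lemma horner_mx_size3 n (A : 'M[F]_n.+1) (r : {poly F}) : (size r <= 3)%N ->
  horner_mx A r = (r`_0)%:M + r`_1 *: A + r`_2 *: (A *m A).
Proof.
move=> sr; have rE : r = (r`_0)%:P + r`_1 *: 'X + r`_2 *: ('X * 'X).
  apply/polyP => -[|[|[|i]]]; rewrite !coefE /= ?mulr0 ?mulr1 ?addr0 ?add0r //.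
  by rewrite nth_default // (leq_trans sr).
by rewrite {1}rE !rmorphD /= !horner_mxZ rmorphM /= horner_mx_X horner_mx_C.
Qed.

End CharPoly3.

Section Cubic.
Variable C : numClosedFieldType.
Implicit Types A B T : 'M[C]_3.

(** Coordinates on the algebra generated by [T], with [\adj T] replacing the square: the Frobenius
    form then involves just the quantities compared in [fdiff]. *)
Definition adj_comb T (c0 c1 c2 : C) := c0%:M + c1 *: T + c2 *: \adj T.

Lemma tr_adj_comb T c0 c1 c2 :
  \tr (adj_comb T c0 c1 c2) = 3 * c0 + c1 * \tr T + c2 * \tr (\adj T).
Proof. by rewrite !mxtraceD !mxtraceZ mxtrace_scalar; ring. Qed.

Lemma fro_adj_comb T c0 c1 c2 : fro (adj_comb T c0 c1 c2) =
  3 * `|c0| ^+ 2 + (c0^* * c1 * \tr T + c0 * c1^* * (\tr T)^*)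
  + (c0^* * c2 * \tr (\adj T) + c0 * c2^* * (\tr (\adj T))^*)
  + `|c1| ^+ 2 * fro T
  + (c1^* * c2 * mxdot T (\adj T) + c1 * c2^* * (mxdot T (\adj T))^*)
  + `|c2| ^+ 2 * fro (\adj T).
Proof.
rewrite /adj_comb -[c0%:M]scalemx1 /fro !(mxdotDl, mxdotDr, mxdotZl, mxdotZr).
rewrite -(mxdotC 1%:M T) -(mxdotC 1%:M (\adj T)) -(mxdotC T (\adj T)) !mxdot1
  mxtrace1.
by rewrite !normCK; ring.
Qed.

Lemma adj_resolvent T z :
  \adj (z%:M - T) = adj_comb T (z ^+ 2 - z * \tr T) z 1.
Proof.
have e2 : \tr (\adj (z%:M - T)) = 3 * z ^+ 2 - 2 * z * \tr T + \tr (\adj T).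
  apply: (mulfI (_ : 2 != 0)); first by rewrite pnatr_eq0.
  rewrite double_tr_adj mulmxBl !mulmxBr !mul_scalar_mx !mul_mx_scalar.
  rewrite scale_scalar_mx !raddfB /= !mxtraceZ !mxtrace_scalar.
  have -> : \tr (T *m T) = \tr T ^+ 2 - 2 * \tr (\adj T).
    by rewrite double_tr_adj; ring.
  ring.
have trz : \tr (z%:M - T) = 3 * z - \tr T by rewrite raddfB /= mxtrace_scalar;
  ring.
rewrite adjE3 e2 trz mulmxBl !mulmxBr !mul_scalar_mx !mul_mx_scalar.
rewrite /adj_comb [\adj T in RHS]adjE3;
  move: (T *m T) (\tr T) (\tr (\adj T)) => TT t e.
by apply/matrixP => i j; rewrite !mxE; case: (i == j); rewrite ?mulr1n ?mulr0n;
  ring.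
Qed.

Variables A B : 'M[C]_3.
Hypothesis charAB : char_poly A = char_poly B.

Lemma horner_adj_comb p : exists c0 c1 c2,
  horner_mx A p = adj_comb A c0 c1 c2 /\ horner_mx B p = adj_comb B c0 c1 c2.
Proof.
have [trE adjE _] := char_poly_invariants charAB.
pose r := p %% char_poly A.
have sr : (size r <= 3)%N.
  by rewrite -ltnS -(size_char_poly A) ltn_modp monic_neq0 ?char_poly_monic.
have comb T : \tr T = \tr A -> \tr (\adj T) = \tr (\adj A) ->
    horner_mx T (char_poly A) = 0 -> horner_mx T p =
    adj_comb T (r`_0 - r`_2 * \tr (\adj A)) (r`_1 + r`_2 * \tr A) (r`_2).
  move=> tT aT mT; rewrite (horner_mx_mod p mT) -/r (horner_mx_size3 T sr).
  rewrite /adj_comb [\adj T]adjE3 tT aT; move: (T *m T) => TT.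
  move: (\tr A) (\tr (\adj A)) => t e.
  by apply/matrixP => i j; rewrite !mxE; case: (i == j);
    rewrite ?mulr1n ?mulr0n; ring.
exists (r`_0 - r`_2 * \tr (\adj A)), (r`_1 + r`_2 * \tr A), (r`_2).
split; apply: comb => //; first exact: Cayley_Hamilton.
by rewrite charAB; exact: Cayley_Hamilton.
Qed.

Lemma tr_horner p : \tr (horner_mx A p) = \tr (horner_mx B p).
Proof.
have [trE adjE _] := char_poly_invariants charAB.
by have [c0 [c1 [c2 [-> ->]]]] := horner_adj_comb p;
  rewrite !tr_adj_comb trE adjE.
Qed.

Hypothesis froAB : fro A = fro B.
Hypothesis dotAB : mxdot A (\adj A) = mxdot B (\adj B).
Hypothesis froadjAB : fro (\adj A) = fro (\adj B).

Lemma fro_horner p : fro (horner_mx A p) = fro (horner_mx B p).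
Proof.
have [trE adjE _] := char_poly_invariants charAB.
have [c0 [c1 [c2 [-> ->]]]] := horner_adj_comb p; rewrite !fro_adj_comb.
by rewrite trE adjE froAB dotAB froadjAB.
Qed.

(** By [adjE3] the adjugate is a polynomial in the matrix whose coefficients are traces, and these
    agree for [A] and [B]; hence one [q] serves both. *)
Lemma adj_horner p : exists q,
  \adj (horner_mx A p) = horner_mx A q /\ \adj (horner_mx B p) = horner_mx B q.
Proof.
have trp := tr_horner p.
have e2p : \tr (\adj (horner_mx A p)) = \tr (\adj (horner_mx B p)).
  apply: (mulfI (_ : 2 != 0)); first by rewrite pnatr_eq0.
  by have := tr_horner (p * p); rewrite !double_tr_adj trp !rmorphM /= => ->.
exists (p * p - \tr (horner_mx A p) *: p + (\tr (\adj (horner_mx A p)))%:P).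
split; rewrite [LHS]adjE3 rmorphD rmorphB rmorphM /= horner_mxZ horner_mx_C.
  by [].
by rewrite trp e2p.
Qed.

Lemma svcubic_horner p : svcubic (horner_mx A p) =1 svcubic (horner_mx B p).
Proof.
move=> t; have [q [qA qB]] := adj_horner p.
have detp : \det (horner_mx A p) = \det (horner_mx B p).
  apply: (mulfI (_ : 3 != 0)); first by rewrite pnatr_eq0.
  (* This presents the determinant as a third of the trace of a polynomial in the matrix. *)
  have trdet T : 3 * \det T = \tr (T *m \adj T).
    by rewrite mul_mx_adj mxtrace_scalar mulr_natl.
  rewrite !trdet qA qB; have := tr_horner (p * q).
  by rewrite !rmorphM.
by rewrite /svcubic qA qB !fro_horner detp.
Qed.

End Cubic.

Section CubicConverse.
Variable C : numClosedFieldType.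
Variables A B : 'M[C]_3.
Hypothesis charAB : char_poly A = char_poly B.
Hypothesis normAB : forall z, ~~ root (char_poly A) z ->
  exists s, is_sqnorm (\adj (z%:M - A)) s /\ is_sqnorm (\adj (z%:M - B)) s.
Hypothesis nscalA : ~~ is_scalar_mx A.

Lemma adjK3 (T : 'M[C]_3) : \det T != 0 -> \adj (\adj T) = \det T *: T.
Proof.
move=> dT; have uT : T \in unitmx by rewrite unitmxE unitfE.
have uA : \adj T \in unitmx.
  rewrite unitmxE unitfE; apply: contra_neq dT => d0.
  have := congr1 determinant (mul_mx_adj T).
  by rewrite det_mulmx d0 mulr0 det_scalar => /esym /eqP;
    rewrite expf_eq0 => /eqP.
apply: (can_inj (mulKmx uA)); rewrite mul_mx_adj -scalemxAr mul_adj_mx.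
rewrite scale_scalar_mx; congr (_%:M).
apply: (mulfI dT); rewrite -det_mulmx mul_mx_adj det_scalar; ring.
Qed.

Let k := fro A - fro B.
Let eta := mxdot A (\adj A) - mxdot B (\adj B).
Let theta := fro (\adj A) - fro (\adj B).

Lemma conj_k : k^* = k.
Proof. by rewrite rmorphB /= !geC0_conj ?fro_ge0. Qed.

Definition fdiff (z : C) := `|z| ^+ 2 * k + (z^* * eta + z * eta^*) + theta.

Lemma fdiffE z : fro (\adj (z%:M - A)) - fro (\adj (z%:M - B)) = fdiff z.
Proof.
have [trE adjE _] := char_poly_invariants charAB.
rewrite !adj_resolvent !fro_adj_comb trE adjE /fdiff /k /eta /theta.
rewrite rmorphB normr1 rmorph1 /=; ring.
Qed.

Lemma fro_resolventE (T : 'M[C]_3) z :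
  fro (z%:M - T) = 3 * `|z| ^+ 2 - (z^* * \tr T + z * (\tr T)^*) + fro T.
Proof.
have -> : z%:M - T = adj_comb T z (-1) 0.
  by rewrite /adj_comb scale0r addr0 scaleN1r.
by rewrite fro_adj_comb rmorphN rmorph1 rmorph0 normrN normr1 normr0 /=; ring.
Qed.

(** [D] is [|\det (z - A)|^2]. The cubics of both adjugates have the root [s]; in their difference
    the linear coefficients [D * fro (z - T)] leave [D * k], as the traces agree. The final bound
    applies the norm of [\adj (z - A)] to [(z - A) v]. *)
Lemma resolvent_relation z : ~~ root (char_poly A) z -> exists s D,
  [/\ 0 < s, 0 < D, fdiff z * s = D * k &
      forall v : 'cV_3, D * fro v <= s * fro ((z%:M - A) *m v)].
Proof.
move=> hz; have [s [sA sB]] := normAB hz.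
have dA : \det (z%:M - A) != 0 by rewrite -horner_char_poly.
have dAB : \det (z%:M - A) = \det (z%:M - B) by rewrite -!horner_char_poly
  charAB.
have dB : \det (z%:M - B) != 0 by rewrite -dAB.
pose D := `|\det (z%:M - A)| ^+ 2.
have D0 : 0 < D by rewrite exprn_gt0 // normr_gt0.
have detadj (T : 'M[C]_3) : \det T != 0 -> \det (\adj T) = \det T ^+ 2.
  move=> dT; apply: (mulfI dT); rewrite -det_mulmx mul_mx_adj.
  by rewrite det_scalar; ring.
have cubic T : \det T = \det (z%:M - A) -> svcubic (\adj T) s =
    s ^+ 3 - fro (\adj T) * s ^+ 2 + D * fro T * s - D ^+ 2.
  move=> dT; have dT0 : \det T != 0 by rewrite dT.
  by rewrite /svcubic adjK3 // froZ detadj // normrX dT.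
have cA := sqnorm_root sA; have cB := sqnorm_root sB.
rewrite cubic // in cA; rewrite cubic // in cB.
have s0 : 0 < s.
  rewrite lt0r (sqnorm_ge0 sA) andbT; apply: contraTneq D0 => s0.
  move/eqP: cA; rewrite s0 !expr0n /= !mulr0 subrr add0r sub0r oppr_eq0.
  by rewrite sqrf_eq0 => /eqP ->; rewrite ltxx.
exists s, D; split=> //.
  have [trE adjE _] := char_poly_invariants charAB.
  have s_neq0 := lt0r_neq0 s0.
  apply: (mulIf s_neq0); apply/eqP; rewrite -subr_eq0; apply/eqP.
  transitivity ((s ^+ 3 - fro (\adj (z%:M - B)) * s ^+ 2 + D * fro (z%:M - B) *
    s - D ^+ 2)
    - (s ^+ 3 - fro (\adj (z%:M - A)) * s ^+ 2 + D * fro (z%:M - A) * s - D ^+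
      2)).
    rewrite -fdiffE !fro_resolventE trE /k; ring.
  by rewrite cA cB subrr.
move=> v; have := sA.2 ((z%:M - A) *m v).
by rewrite mulmxA mul_adj_mx mul_scalar_mx froZ.
Qed.

Lemma same_invariants :
  [/\ fro A = fro B, mxdot A (\adj A) = mxdot B (\adj B) &
      fro (\adj A) = fro (\adj B)].
Proof.
have h0 : char_poly A != 0 by rewrite monic_neq0 ?char_poly_monic.
have [k0|k0] := eqVneq k 0.
  (* For [k = 0] the function [fdiff] is real-affine in [z] and vanishes off the spectrum, so its
     linear part is bounded there and must be zero. *)
  have f0 z : ~~ root (char_poly A) z -> fdiff z = 0.
    move=> /resolvent_relation [s [D [s0 _ E _]]].
    by move/eqP: E; rewrite k0 mulr0 mulf_eq0 (gt_eqF s0) orbF => /eqP.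
  have eta0 : eta = 0.
    apply: (linear_bounded_off_roots (c := - theta) h0) => z /f0.
    rewrite /fdiff k0 mulr0 add0r => /eqP; rewrite addr_eq0 => /eqP ->.
    exact: lexx.
  have [j /f0] := nat_nonroot h0.
  rewrite /fdiff k0 eta0 conjC0 !mulr0 !add0r => theta0.
  by split; apply/eqP; rewrite -subr_eq0; apply/eqP.
(* Otherwise the numerical range of [A] would reduce to [- eta / k]. *)
have Ascal : A + (eta / k)%:M = 0.
  apply: quadratic_form0 => v.
  apply: (linear_bounded_off_roots (c := fro (A *m v) - theta / k * fro v) h0)
    => z hz.
  have [s [D [s0 D0 E /(_ v)]]] := resolvent_relation hz.
  (* Replacing [D] allows [s] to be cancelled. The terms in [|z|^2] then drop out on both sides, and
     a bound on a real-linear function of [z] remains. *)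
  have -> : D = fdiff z / k * s by rewrite mulrAC E mulfK.
  rewrite mulrAC -[leRHS]mulrC ler_pM2r // mulmxBl mul_scalar_mx.
  have -> : fro (z *: v - A *m v) = `|z| ^+ 2 * fro v -
     (z^* * mxdot v (A *m v) + z * (mxdot v (A *m v))^*) + fro (A *m v).
    rewrite -scaleN1r /fro !(mxdotDl, mxdotDr, mxdotZl, mxdotZr) rmorphN
      rmorph1 normCK mxdotC.
    ring.
  rewrite mulmxDl mul_scalar_mx mxdotDr mxdotZr -/(fro v) => le_f.
  rewrite -subr_ge0; rewrite -subr_ge0 in le_f; congr (is_true (0 <= _)): le_f.
  have conj_affine (x e l f : C) : l^* = l -> f^* = f ->
      (x + e / l * f)^* = x^* + e^* / l * f.
    by move=> {2}<- {2}<-; rewrite rmorphD !rmorphM fmorphV.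
  rewrite conj_affine ?conj_k ?(geC0_conj (fro_ge0 v)) // /fdiff.
  by field.
case/negP: nscalA; apply/is_scalar_mxP; exists (- (eta / k)).
by apply/eqP; rewrite -subr_eq0 raddfN /= opprK Ascal.
Qed.

End CubicConverse.

Section DegreeThree.
Variable R : realType.
Local Notation C := R[i].
Implicit Types A B : 'M[C]_3.

Lemma char_poly_minpoly3 A : size (mxminpoly A) = 4%N -> char_poly A =
  mxminpoly A.
Proof.
move=> sA; apply/eqP; rewrite -eqp_monic ?mxminpoly_monic ?char_poly_monic //
  eqp_sym.
by rewrite -dvdp_size_eqp ?mxminpoly_dvd_char // size_char_poly sA.
Qed.

(** Both sides are [m(z)] times the inverse of [z - A]. *)
Lemma horner_rpoly_adj A m z : horner_mx A m = 0 -> m = char_poly A -> ~~ root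
  m z ->
  horner_mx A (rpoly m z) = \adj (z%:M - A).
Proof.
move=> mA mE mz; have dz : m.[z] = \det (z%:M - A) by rewrite mE
  horner_char_poly.
have uz : z%:M - A \in unitmx by rewrite unitmxE unitfE -dz.
by apply: (can_inj (mulKmx uz)); rewrite (mul_rpoly z mA) mul_mx_adj dz.
Qed.

Lemma same_pseudospectra_isometric3 A B : mxminpoly A = mxminpoly B ->
  size (mxminpoly A) = 4%N -> same_pseudospectra A B -> poly_isometric A B.
Proof.
move=> mAB sA /(same_pseudospectra_minpolyE mAB) AB p.
have cA := char_poly_minpoly3 sA.
have cB : char_poly B = mxminpoly B by apply: char_poly_minpoly3; rewrite -mAB.
have charAB : char_poly A = char_poly B := etrans cA (etrans mAB (esym cB)).
have nscal : ~~ is_scalar_mx A.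
  by rewrite -mxminpoly_linear_is_scalar -ltnNge -ltnS -size_mxminpoly sA.
have rA z := horner_rpoly_adj (z := z) (mx_root_minpoly A) (esym cA).
have rB z := horner_rpoly_adj (z := z) (mx_root_minpoly B) (esym cB).
have [z mz|fAB dAB faAB] := same_invariants charAB _ nscal.
  rewrite cA in mz; have E := AB z mz; rewrite (rA z mz) in E.
  rewrite {}mAB in mz E; rewrite (rB z mz) in E.
  have [s sA'] := ex_sqnorm (\adj (z%:M - A)).
  by exists s; split; [exact: sA'|exact: sqnorm_specnorm E sA'].
have [s pA] := ex_sqnorm (horner_mx A p);
  have [t pB] := ex_sqnorm (horner_mx B p).
have st := sqnorm_eq_svcubic (svcubic_horner charAB fAB dAB faAB p) pA pB.
by rewrite -st in pB; exact: specnorm_eq pA pB.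
Qed.

End DegreeThree.

(** * Minimal polynomials of degree two *)

Section DegreeTwo.
Variable C : numClosedFieldType.
Implicit Types A : 'M[C]_3.

Lemma monic_size2 (F : fieldType) (p : {poly F}) :
  p \is monic -> size p = 2%N -> exists a, p = 'X - a%:P.
Proof.
move=> /monicP; rewrite /lead_coef => lp sp; rewrite sp /= in lp.
exists (- p`_0); apply/polyP => -[|[|i]];
  rewrite !coefE /= ?subr0 ?sub0r ?opprK //.
by rewrite nth_default // sp.
Qed.

(** Allows [g = h], where [A - g] squares to zero, so no case distinction on the spectrum is
    needed. *)
Definition double_simple A (g h : C) :=
  mxminpoly A = ('X - g%:P) * ('X - h%:P) /\
  char_poly A = ('X - g%:P) ^+ 2 * ('X - h%:P).

(** The quotient of the characteristic by the minimal polynomial is some [X - g], and [g], being an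
    eigenvalue, is also a root of the minimal polynomial. *)
Lemma minpoly2_double_simple A : size (mxminpoly A) = 3%N ->
  exists g h, double_simple A g h.
Proof.
move=> sA; have mm := mxminpoly_monic A.
have /dvdpP [q qE] := mxminpoly_dvd_char A.
have qm : q \is monic by rewrite -(monicMr _ mm) -qE char_poly_monic.
have sq : size q = 2%N.
  have := size_char_poly A; rewrite qE size_Mmonic ?monic_neq0 // sA addn3 =>
    -[] //.
have [g gE] := monic_size2 qm sq.
have /factor_theorem [r rE] : root (mxminpoly A) g.
  by rewrite root_mxminpoly qE gE rootM root_XsubC eqxx.
have rm : r \is monic by rewrite -(monicMr _ (monicXsubC g)) -rE.
have sr : size r = 2%N.
  by move: sA; rewrite rE size_Mmonic ?monic_neq0 ?monicXsubC // size_XsubC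
    addn2 => -[].
have [h hE] := monic_size2 rm sr.
exists g, h; split; first by rewrite rE hE mulrC.
by rewrite qE gE rE hE; ring.
Qed.

Section Fixed.
Variables (A : 'M[C]_3) (g h : C).
Hypothesis Agh : double_simple A g h.
Let N := A - g%:M.

Lemma double_simple_size : size (mxminpoly A) = 3%N.
Proof. by rewrite Agh.1 size_mul ?polyXsubC_eq0 // !size_XsubC. Qed.

Lemma double_simple_sq : N *m N = (h - g) *: N.
Proof.
have := mx_root_minpoly A;
  rewrite Agh.1 rmorphM !rmorphB /= horner_mx_X !horner_mx_C => AA.
have NE : A - h%:M = N - (h - g)%:M by rewrite /N raddfB /= opprB addrA subrK.
move/eqP: AA; rewrite -[_ * _]/(_ *m _) NE -/N mulmxBr mul_mx_scalar subr_eq0.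
by move/eqP.
Qed.

Lemma double_simple_tr : \tr N = h - g.
Proof.
have f t : t ^+ 3 - \tr A * t ^+ 2 + \tr (\adj A) * t - \det A = (t - g) ^+ 2 *
  (t - h).
  by rewrite -char_polyE3 -horner_char_poly Agh.2 !hornerE.
have : 2 * \tr A = 2 * (g *+ 2 + h).
  have := f 0; have := f 1; have := f (-1).
  move: (\tr A) (\tr (\adj A)) (\det A) => a b c fm f1 f0.
  (* The second difference at -1, 0, 1 isolates the coefficient of [t^2]. *)
  transitivity (- ((-1) ^+ 3 - a * (-1) ^+ 2 + b * -1 - c + (1 ^+ 3 - a * 1 ^+
    2 + b * 1 - c) - 2 * (0 ^+ 3 - a * 0 ^+ 2 + b * 0 - c))).
    ring.
  by rewrite fm f1 f0; ring.
move/(mulfI (_ : 2 != 0)) => trA; rewrite raddfB /= mxtrace_scalar trA;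
  last by rewrite pnatr_eq0.
ring.
Qed.

(** [svquad] for [r(A) = r(g) + r_1 (A - g)], in terms of the eigenvalues [r(g)] and [r(h)];
    exchanging these affects nothing outside the defect. *)
Definition quad (r : {poly C}) t := t ^+ 2 -
  (`|r.[g]| ^+ 2 + `|r.[h]| ^+ 2 + `|r`_1| ^+ 2 * defect N (h - g)) * t
  + `|r.[g]| ^+ 2 * `|r.[h]| ^+ 2.

Lemma double_simple_sqnorm p s : is_sqnorm (horner_mx A p) s ->
  quad (p %% mxminpoly A) s = 0 /\
  forall t, quad (p %% mxminpoly A) t = 0 -> t <= s.
Proof.
rewrite (horner_mx_mod p (mx_root_minpoly A)); set r := p %% _ => sp.
have sr : (size r <= 2)%N.
  by rewrite -ltnS -double_simple_size ltn_modp monic_neq0 ?mxminpoly_monic.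
have rx x : r.[x] = r`_0 + r`_1 * x.
  by rewrite (horner_coef_wide _ sr) !big_ord_recl big_ord0 /= expr0 expr1
    mulr1 addr0.
have rA : horner_mx A r = r.[g]%:M + r`_1 *: N.
  rewrite (horner_mx_size3 _ (leq_trans sr _)) // [r`_2]nth_default // scale0r
    addr0.
  rewrite rx /N; apply/matrixP => i j; rewrite !mxE.
  by case: (i == j); rewrite ?mulr1n ?mulr0n; ring.
rewrite rA in sp.
have := svquad_sqnorm double_simple_sq double_simple_tr sp.
have rh : r.[g] + r`_1 * (h - g) = r.[h] by rewrite !rx; ring.
by rewrite /svquad rh.
Qed.

(** Otherwise the square of [X - g'] would be coprime to that of [X - g] and would divide the linear
    factor [X - h]. *)
Lemma largest_mult_double_simple g' :
  (mup g (char_poly A) <= mup g' (char_poly A))%N -> g' = g.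
Proof.
move=> le_mup; apply/eqP; apply: contraT => gg'.
have c0 : char_poly A != 0 by rewrite monic_neq0 ?char_poly_monic.
have : (2 <= mup g' (char_poly A))%N.
  by apply: leq_trans le_mup; rewrite mup_geq // Agh.2 dvdp_mulr.
rewrite mup_geq // Agh.2 Gauss_dvdpr; last first.
  rewrite coprimep_expl // coprimep_expr // coprimep_XsubC root_XsubC.
  by rewrite eq_sym.
move/dvdp_leq; rewrite polyXsubC_eq0 size_XsubC size_exp_XsubC => /(_ isT).
by [].
Qed.

End Fixed.
End DegreeTwo.

Lemma XsubC_pair_eq (F : idomainType) (a b c d : F) :
  ('X - a%:P) * ('X - b%:P) = ('X - c%:P) * ('X - d%:P) ->
  (c = a /\ d = b) \/ (c = b /\ d = a).
Proof.
move=> E; have e x : (x - a) * (x - b) = (x - c) * (x - d).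
  by have := congr1 (horner^~ x) E; rewrite !hornerM !hornerXsubC.
have := e c; rewrite subrr mul0r => /eqP; rewrite mulf_eq0 !subr_eq0.
have sum : a + b = c + d.
  have -> : a + b = 1 + (0 - a) * (0 - b) - (1 - a) * (1 - b) by ring.
  rewrite !e; ring.
case/orP => /eqP ca; [left|right]; split=> //; apply: (addrI c).
  by rewrite -sum ca.
by rewrite -sum ca addrC.
Qed.

Section QuadraticComparison.
Variable C : numClosedFieldType.
Variables (A B : 'M[C]_3) (g h g' h' : C).
Hypothesis mAB : mxminpoly A = mxminpoly B.
Hypotheses (Agh : double_simple A g h) (Bgh : double_simple B g' h').

(** The minimal polynomial fixes only the unordered pair: the double eigenvalue of [A] may be the
    simple one of [B]. *)
Lemma double_simple_eigenvalues : (g' = g /\ h' = h) \/ (g' = h /\ h' = g).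
Proof. exact: XsubC_pair_eq (etrans (esym Agh.1) (etrans mAB Bgh.1)). Qed.

Lemma normr_gap : `|h' - g'| = `|h - g|.
Proof.
by have [[-> ->]|[-> ->]] := double_simple_eigenvalues; [|exact: distrC].
Qed.

Lemma quadB r t : quad B g' h' r t = quad A g h r t +
  `|r`_1| ^+ 2 * (defect (A - g%:M) (h - g) - defect (B - g'%:M) (h' - g')) * t.
Proof.
rewrite /quad; move: (defect _ _) (defect (A - _) _) => e d.
by have [[-> ->]|[-> ->]] := double_simple_eigenvalues; ring.
Qed.

Lemma sqnorm_defect p s t :
  defect (A - g%:M) (h - g) = defect (B - g'%:M) (h' - g') ->
  is_sqnorm (horner_mx A p) s -> is_sqnorm (horner_mx B p) t -> s = t.
Proof.
move=> dAB pA pB; have qAB r x : quad B g' h' r x = quad A g h r x.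
  by rewrite quadB dAB subrr mulr0 mul0r addr0.
have [sA mA] := double_simple_sqnorm Agh pA.
have [tB mB] := double_simple_sqnorm Bgh pB.
rewrite -mAB in tB mB.
by apply/le_anti/andP; split; [apply: mB; rewrite qAB | apply: mA;
  rewrite -qAB].
Qed.

(** One polynomial of degree one suffices: at the common root [s] the two quadratics differ by
    [|p_1|^2 s] times the difference of the defects. *)
Lemma defect_sqnorm (p : {poly C}) (s : C) : size p = 2%N -> s != 0 ->
  is_sqnorm (horner_mx A p) s -> is_sqnorm (horner_mx B p) s ->
  defect (A - g%:M) (h - g) = defect (B - g'%:M) (h' - g').
Proof.
move=> sp s0 pA pB.
have pm : p %% mxminpoly A = p.
  by apply: modp_small; rewrite sp (double_simple_size Agh).
have [qA _] := double_simple_sqnorm Agh pA.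
have [qB _] := double_simple_sqnorm Bgh pB.
rewrite -mAB pm in qB; rewrite pm in qA.
have p1 : p`_1 != 0.
  by have := lead_coef_eq0 p; rewrite /lead_coef sp /= => ->;
    rewrite -size_poly_eq0 sp.
move/eqP: qB; rewrite quadB qA add0r !mulf_eq0 (negPf s0) orbF.
by rewrite !normr_eq0 (negPf p1) /= subr_eq0 => /eqP.
Qed.

End QuadraticComparison.

Lemma size_rpoly (F : fieldType) (m : {poly F}) z :
  (1 < size m)%N -> size (rpoly m z) = (size m).-1.
Proof.
move=> sm; have := congr1 (size : {poly F} -> nat) (rpolyE m z).
rewrite size_polyDl; last first.
  by rewrite size_polyN (leq_ltn_trans (size_polyC_leq1 _)).
have [->|r0] := eqVneq (rpoly m z) 0.
  by rewrite mul0r size_poly0 => m0; rewrite -m0 in sm.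
by rewrite size_Mmonic ?monicXsubC // size_XsubC addn2 => <-.
Qed.

Section QuadraticPseudospectra.
Variable R : realType.
Local Notation C := R[i].
Variables (A B : 'M[C]_3) (g h g' h' : C).
Hypothesis mAB : mxminpoly A = mxminpoly B.
Hypotheses (Agh : double_simple A g h) (Bgh : double_simple B g' h').

Lemma defect_isometric :
  defect (A - g%:M) (h - g) = defect (B - g'%:M) (h' - g') -> poly_isometric A
    B.
Proof.
move=> dAB p.
have [s pA] := ex_sqnorm (horner_mx A p);
  have [t pB] := ex_sqnorm (horner_mx B p).
have st := sqnorm_defect mAB Agh Bgh dAB pA pB.
by rewrite -st in pB; exact: specnorm_eq pA pB.
Qed.

Lemma same_pseudospectra_defect : same_pseudospectra A B ->
  defect (A - g%:M) (h - g) = defect (B - g'%:M) (h' - g').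
Proof.
move=> /(same_pseudospectra_minpolyE mAB) AB.
have m0 : mxminpoly A != 0 by exact/monic_neq0/mxminpoly_monic.
have sm := double_simple_size Agh.
(* A single point off the spectrum is enough: the numerator of the resolvent there has degree one
   and a nonzero value at [A]. *)
have [k mz] := nat_nonroot m0.
have E := AB _ mz.
have [s pA] := ex_sqnorm (horner_mx A (rpoly (mxminpoly A) k%:R)).
have pB := sqnorm_specnorm E pA.
apply: (defect_sqnorm mAB Agh Bgh _ _ pA pB); first by rewrite size_rpoly sm.
apply: contraNneq (horner_rpoly_neq0 A k%:R) => s0; apply/eqP.
by rewrite s0 in pA; exact/sqnorm0.
Qed.

(** The eigenvalue gaps have equal modulus, so the defects differ only through the Frobenius
    norms. *)
Lemma frobnorm_defect : frobnorm (A - g%:M) = frobnorm (B - g'%:M) <->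
  defect (A - g%:M) (h - g) = defect (B - g'%:M) (h' - g').
Proof.
rewrite /defect (normr_gap mAB Agh Bgh) -!frobnorm_fro;
  split=> [->//|/addIr/complexI E].
by apply: (@pexpIrn _ 2 isT _ _ _ _ E); rewrite nnegrE; exact: sqrtr_ge0.
Qed.

End QuadraticPseudospectra.

(** * Assembly according to the degree of the minimal polynomial *)

Lemma size_mxminpoly3 (F : fieldType) (A : 'M[F]_3) :
  [\/ size (mxminpoly A) = 2%N, size (mxminpoly A) = 3%N
    | size (mxminpoly A) = 4%N].
Proof.
have : (1 < size (mxminpoly A) <= 4)%N.
  rewrite {1}size_mxminpoly ltnS mxminpoly_nonconstant -(size_char_poly A).
  by rewrite dvdp_leq ?mxminpoly_dvd_char // monic_neq0 ?char_poly_monic.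
by case: size => [|[|[|[|[|]]]]] // _;
  [constructor 1|constructor 2|constructor 3].
Qed.

Lemma mxminpoly_XsubC (F : fieldType) n (A : 'M[F]_n.+1) a :
  mxminpoly A = 'X - a%:P -> A = a%:M.
Proof.
move=> mA; have := mx_root_minpoly A;
  rewrite mA rmorphB /= horner_mx_X horner_mx_C.
by move/eqP; rewrite subr_eq0 => /eqP.
Qed.

Theorem theorem10 (R : realType) (A B : 'M[R[i]]_3) :
  (same_pseudospectra A B <-> poly_isometric A B) /\
  (mxminpoly A = mxminpoly B -> size (mxminpoly A) = 3%N ->
   forall gA gB : R[i],
     largest_mult_eigenvalue A gA -> largest_mult_eigenvalue B gB ->
     (same_pseudospectra A B <->
        frobnorm (A - gA%:M) = frobnorm (B - gB%:M))).
Proof.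
split.
  split; last exact: poly_isometric_same_pseudospectra.
  move=> AB; have mAB := same_pseudospectra_minpoly AB.
  have [sA|sA|sA] := size_mxminpoly3 A.
  (* In degree one both matrices are the same scalar matrix. *)
  - have [a mE] := monic_size2 (mxminpoly_monic A) sA.
    by rewrite (mxminpoly_XsubC mE) (mxminpoly_XsubC (etrans (esym mAB) mE)).
  - have [g [h Agh]] := minpoly2_double_simple sA.
    have sB := sA; rewrite mAB in sB.
    have [g' [h' Bgh]] := minpoly2_double_simple sB.
    exact: defect_isometric mAB Agh Bgh (same_pseudospectra_defect mAB Agh Bgh AB).
  - exact: same_pseudospectra_isometric3 mAB sA AB.
move=> mAB sA gA gB [_ lA] [_ lB].
have [g [h Agh]] := minpoly2_double_simple sA.
have sB := sA; rewrite mAB in sB.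
have [g' [h' Bgh]] := minpoly2_double_simple sB.
rewrite (largest_mult_double_simple Agh (lA g)).
rewrite (largest_mult_double_simple Bgh (lB g')).
split=> [AB|].
  exact/(frobnorm_defect mAB Agh Bgh)/(same_pseudospectra_defect mAB Agh Bgh).
move=> /(frobnorm_defect mAB Agh Bgh) dAB.
exact/poly_isometric_same_pseudospectra/(defect_isometric mAB Agh Bgh).
Qed.
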